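(* Let $[\mathbf H^N]=[\mathbf H^1\cdots\mathbf H^N]$ be the random matrix with values in $\mathbb M_{\nu,N}$ whose columns are $N$ independent copies of the $\mathbb R^\nu$-valued random variable $\mathbf H^{(N)}$ with pdf $p^{(N)}_{\mathbf H}$. Then the probability measure of $[\mathbf H^N]$ admits, with respect to $d[\eta]=\otimes_{\ell=1}^Nd\eta^\ell$, the density on $\mathbb M_{\nu,N}$ $$p_{[\mathbf H^N]}([\eta])=\prod_{\ell=1}^N\Big\{\frac1N\sum_{j=1}^N\frac1{(\sqrt{2\pi}\,\widehat s)^\nu}\exp\Big\{-\frac1{2\widehat s^2}\Big\|\frac{\widehat s}s\eta_d^j-\eta^\ell\Big\|^2\Big\}\Big\},\qquad[\eta]=[\eta^1\cdots\eta^N]\in\mathbb M_{\nu,N}.$$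
   Context: $\mathbb M_{\nu,N}$ is the set of real $\nu\times N$ matrices; $d\eta^\ell$ is Lebesgue measure on $\mathbb R^\nu$. $1\le\nu<N$ are integers, $\eta_d^1,\dots,\eta_d^N\in\mathbb R^\nu$ are given points with $\sum_j\eta_d^j=0$ and $\frac1{N-1}\sum_j\eta_d^j(\eta_d^j)^T=[I_\nu]$. Set $s=\big(\frac4{N(\nu+2)}\big)^{1/(\nu+4)}$, $\widehat s=s\big(s^2+\frac{N-1}N\big)^{-1/2}$ and $$p_{\mathbf H}^{(N)}(\eta)=\frac1N\sum_{j=1}^N\pi_{\nu,N}\Big(\frac{\widehat s}s\eta_d^j-\eta\Big),\qquad\pi_{\nu,N}(\eta)=\frac1{(\sqrt{2\pi}\,\widehat s)^\nu}\exp\Big\{-\frac1{2\widehat s^2}\|\eta\|^2\Big\},\qquad\eta\in\mathbb R^\nu.$$ *)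

(* Defs.v *)
From HB Require Import structures.
From mathcomp Require Import all_boot all_order all_algebra.
From mathcomp Require Import all_classical all_reals all_analysis.

Set Implicit Arguments.
Unset Strict Implicit.
Unset Printing Implicit Defensive.

Import Order.TTheory GRing.Theory Num.Theory.
Import numFieldNormedType.Exports.

Local Open Scope classical_set_scope.
Local Open Scope ring_scope.

Section sigma_algebra_of_matrices.
Variables (R : realType) (m n : nat).

(* On a finite-dimensional space, the sigma-algebra generated by the entries
   is the Borel sigma-algebra. *)
Definition matrix_measurable : set (set 'M[R]_(m, n)) :=
  <<s \bigcup_(ij in [set: 'I_m * 'I_n])
        preimage_set_system setT (fun M : 'M[R]_(m, n) => M ij.1 ij.2)
          (measurable : set (set R)) >>.

Let matrix_measurable0 : matrix_measurable set0.
Proof. exact: sigma_algebra0. Qed.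

Let matrix_measurableC A : matrix_measurable A -> matrix_measurable (~` A).
Proof. exact: sigma_algebraC. Qed.

Let matrix_measurable_bigcup (F : (set 'M[R]_(m, n))^nat) :
  (forall i, matrix_measurable (F i)) -> matrix_measurable (\bigcup_i F i).
Proof. exact: sigma_algebra_bigcup. Qed.

HB.instance Definition _ :=
  @isMeasurable.Build default_measure_display 'M[R]_(m, n) matrix_measurable
    matrix_measurable0 matrix_measurableC matrix_measurable_bigcup.

Lemma measurable_entry i j :
  measurable_fun setT (fun M : 'M[R]_(m, n) => M i j).
Proof.
move=> _ Y mY; apply: sub_sigma_algebra; exists (i, j) => //.
by exists Y.
Qed.

Lemma measurable_fun_matrix d (T : measurableType d) (f : T -> 'M[R]_(m, n)) :
  (forall i j, measurable_fun setT (fun x => f x i j)) ->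
  measurable_fun setT f.
Proof.
move=> mf _ Y mY; rewrite setTI; move: Y mY.
apply: (@smallest_sub _ (sigma_algebra setT) _
  [set Y | measurable (f @^-1` Y)]).
  split => /=.
  - by rewrite preimage_set0.
  - by move=> A mA; rewrite setTD preimage_setC; exact: measurableC.
  - by move=> F mF; rewrite preimage_bigcup; exact: bigcupT_measurable.
move=> Y [[i j] _] [B mB <-] /=; rewrite setTI -comp_preimage.
by have := mf i j measurableT _ mB; rewrite setTI.
Qed.

End sigma_algebra_of_matrices.

Lemma sigma_finite_measure_pack d (T : measurableType d) (R : realType)
    (m : {measure set T -> \bar R}) : sigma_finite setT m ->
  exists m' : {sigma_finite_measure set T -> \bar R},
    m' = m :> (set T -> \bar R).
Proof.
move=> sf.
pose Hs := isSFinite.Build _ _ _ _ (sfinite_measure_sigma_finite sf).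
pose Hf := isSigmaFinite.Build _ _ _ _ sf.
pose m' := HB.pack_for (sigma_finite_measure T R) (Measure.sort m) Hs Hf.
by exists m'.
Qed.

Lemma pushforward_sigma_finite_measure d1 d2 (T1 : measurableType d1)
    (T2 : measurableType d2) (R : realType)
    (m : {sigma_finite_measure set T1 -> \bar R}) (f : T1 -> T2)
    (g : T2 -> T1) :
  measurable_fun setT f -> measurable_fun setT g -> cancel f g ->
  exists m' : {sigma_finite_measure set T2 -> \bar R},
    m' = pushforward m f :> (set T2 -> \bar R).
Proof.
move=> mf mg fK.
pose m1 : {measure set T2 -> \bar R} := measure_function_pushforward__canonical__measure_function_Measure m mf.
have m1E : m1 = pushforward m f :> (set T2 -> \bar R) by [].
have sf : sigma_finite setT m1.
  have /sigma_finiteP[F [FT _ Foo]] := sigma_finiteT m.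
  exists (fun k => g @^-1` F k).
    by rewrite -preimage_bigcup -FT preimage_setT.
  move=> k; have [mF Fy] := Foo k; split.
    by rewrite -[X in measurable X]setTI; exact: mg.
  rewrite m1E /pushforward -comp_preimage (_ : g \o f = id)//.
  by apply/funext => x /=; rewrite fK.
exact: (sigma_finite_measure_pack sf).
Qed.

Lemma product_sigma_finite_measure d1 d2 (T1 : measurableType d1)
    (T2 : measurableType d2) (R : realType)
    (m1 : {sigma_finite_measure set T1 -> \bar R})
    (m2 : {sigma_finite_measure set T2 -> \bar R}) :
  exists m : {sigma_finite_measure set (T1 * T2)%type -> \bar R},
    m = (m1 \x m2)%E :> (set (T1 * T2)%type -> \bar R).
Proof.
pose m : {measure set (T1 * T2)%type -> \bar R} :=
  Measure.clone _ _ _ (m1 \x m2)%E _.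
have /sigma_finiteP[F [TF ndF Foo]] := sigma_finiteT m1.
have /sigma_finiteP[G [TG ndG Goo]] := sigma_finiteT m2.
apply: (sigma_finite_measure_pack (m := m)); exists (fun n => F n `*` G n).
  rewrite -setXTT TF TG predeqE => -[x y]; split.
    move=> [/= [n _ Fnx] [k _ Gky]]; exists (maxn n k) => //; split.
    - by move: x Fnx; exact/subsetPset/ndF/leq_maxl.
    - by move: y Gky; exact/subsetPset/ndG/leq_maxr.
  by move=> [n _ []/= ? ?]; split; exists n.
move=> k; have [mF Fk] := Foo k; have [mG Gk] := Goo k.
split; first exact: measurableX.
by rewrite /m/= product_measure1E// lte_mul_pinfty// ge0_fin_numE.
Qed.

Section power_measure.
Context d (T : measurableType d) (R : realType).
Local Open Scope ereal_scope.

Definition consp n (p : T * n.-tuple T) : n.+1.-tuple T := [tuple of p.1 :: p.2].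

(* The n-fold product of mu with itself, on n.-tuple T. *)
Fixpoint power_measure (mu : set T -> \bar R) n : set (n.-tuple T) -> \bar R :=
  match n with
  | 0 => \d_[tuple]
  | n'.+1 => pushforward (mu \x @power_measure mu n') (@consp n')
  end.
Arguments power_measure mu n A : clear implicits.

Variable mu : {sigma_finite_measure set T -> \bar R}.

Let measurable_consp n : measurable_fun setT (@consp n).
Proof. exact: measurable_cons. Qed.

Let measurable_uncons n : measurable_fun setT
  (fun t : n.+1.-tuple T => (thead t, [tuple of behead t] : n.-tuple T)).
Proof.
apply: measurable_fun_pair; first exact: measurable_tnth.
exact: measurable_behead.
Qed.

Let power_measureP n :
  exists m : {sigma_finite_measure set (n.-tuple T) -> \bar R},
    m = power_measure mu n :> (set _ -> _).
Proof.
elim: n => [|n [m mE]]; first by exists (dirac ([tuple] : 0.-tuple T)).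
rewrite (_ : power_measure mu n.+1 =
  pushforward (mu \x power_measure mu n) (@consp n))// -mE.
have [pm <-] := product_sigma_finite_measure mu m.
apply: (@pushforward_sigma_finite_measure _ _ _ _ _ pm (@consp n)
  (fun t => (thead t, [tuple of behead t]))) => //.
- exact: measurable_consp.
- exact: measurable_uncons.
- by move=> [x t]; rewrite /= theadE; congr (_, _); exact/val_inj.
Qed.

Let power_measure0 n : power_measure mu n set0 = 0.
Proof. by have [m <-] := power_measureP n; exact: measure0. Qed.

Let power_measure_ge0 n A : 0 <= power_measure mu n A.
Proof. by have [m <-] := power_measureP n; exact: measure_ge0. Qed.

Let power_measure_sigma_additive n : semi_sigma_additive (power_measure mu n).
Proof. by have [m <-] := power_measureP n; exact: measure_semi_sigma_additive. Qed.

HB.instance Definition _ n := isMeasure.Build _ _ _ (power_measure mu n)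
  (power_measure0 n) (@power_measure_ge0 n) (@power_measure_sigma_additive n).

Let power_measure_sigma_finite n : sigma_finite setT (power_measure mu n).
Proof. by have [m <-] := power_measureP n; exact: sigma_finiteT. Qed.

HB.instance Definition _ n := Measure_isSigmaFinite.Build _ _ _
  (power_measure mu n) (power_measure_sigma_finite n).

Lemma power_measure_box n (A : 'I_n -> set T) : (forall i, measurable (A i)) ->
  power_measure mu n [set t | forall i, A i (tnth t i)] =
  \prod_(i < n) mu (A i).
Proof.
elim: n A => [|n IH] A mA.
  rewrite big_ord0 /= diracE mem_set//.
  by case.
have mbox : measurable [set t : n.-tuple T | forall i, A (lift ord0 i) (tnth t i)].
  rewrite (_ : [set _ | _] =
    \bigcap_(i in [set: 'I_n]) ((@tnth n T)^~ i @^-1` A (lift ord0 i))).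
    apply: fin_bigcap_measurable => // i _.
    by rewrite -[X in measurable X]setTI; exact: measurable_tnth.
  by apply/seteqP; split => t /= h i; [move=> _|]; exact: h.
rewrite (_ : power_measure mu n.+1 =
  pushforward (mu \x power_measure mu n) (@consp n))// /pushforward.
rewrite (_ : _ @^-1` _ =
    A ord0 `*` [set t : n.-tuple T | forall i, A (lift ord0 i) (tnth t i)]).
  by rewrite product_measure1E// big_ord_recl; congr *%E; exact: IH.
apply/seteqP; split => [[x t] /= h|[x t] [/= h0 h] i].
  by split => [|i]; [exact: (h ord0)|have := h (lift ord0 i); rewrite tnthS].
by case: (unliftP ord0 i) => [j ->|->]; [rewrite tnthS|].
Qed.

End power_measure.
Arguments power_measure {d T R} mu n A.

Section lebesgue_on_matrices.
Context {R : realType}.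

Definition tuple_col n (t : n.-tuple (measurableTypeR R)) : 'cV[R]_n :=
  \col_(i < n) tnth t i.

Definition mx_of_cols m n (t : n.-tuple 'cV[R]_m) : 'M[R]_(m, n) :=
  \matrix_(i < m, j < n) tnth t j i 0.

Definition lebesgue_cV n : set 'cV[R]_n -> \bar R :=
  pushforward (power_measure (@lebesgue_measure R) n) (@tuple_col n).
Arguments lebesgue_cV n A : clear implicits.

Let measurable_tuple_col n : measurable_fun setT (@tuple_col n).
Proof.
apply: measurable_fun_matrix => i j.
rewrite (_ : (fun _ => _) = (@tnth n (measurableTypeR R))^~ i).
  exact: measurable_tnth.
by apply/funext => t; rewrite mxE.
Qed.

Let lebesgue_cVP n : exists m : {sigma_finite_measure set 'cV[R]_n -> \bar R},
  m = lebesgue_cV n :> (set _ -> _).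
Proof.
apply: (@pushforward_sigma_finite_measure _ _ _ _ _
  (power_measure (@lebesgue_measure R) n) _
  (fun v : 'cV[R]_n => [tuple v i 0 | i < n])).
- exact: measurable_tuple_col.
- apply/measurable_fun_tnthP => i.
  rewrite (_ : _ \o _ = fun v : 'cV[R]_n => v i 0); first exact: measurable_entry.
  by apply/funext => v /=; rewrite tnth_mktuple.
- by move=> t; apply: eq_from_tnth => i; rewrite tnth_mktuple mxE.
Qed.

Let lebesgue_cV0 n : lebesgue_cV n set0 = 0%E.
Proof. by have [m <-] := lebesgue_cVP n; exact: measure0. Qed.

Let lebesgue_cV_ge0 n A : (0 <= lebesgue_cV n A)%E.
Proof. by have [m <-] := lebesgue_cVP n; exact: measure_ge0. Qed.

Let lebesgue_cV_sigma_additive n : semi_sigma_additive (lebesgue_cV n).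
Proof. by have [m <-] := lebesgue_cVP n; exact: measure_semi_sigma_additive. Qed.

HB.instance Definition _ n := isMeasure.Build _ _ _ (lebesgue_cV n)
  (lebesgue_cV0 n) (@lebesgue_cV_ge0 n) (@lebesgue_cV_sigma_additive n).

Let lebesgue_cV_sigma_finite n : sigma_finite setT (lebesgue_cV n).
Proof. by have [m <-] := lebesgue_cVP n; exact: sigma_finiteT. Qed.

HB.instance Definition _ n := Measure_isSigmaFinite.Build _ _ _
  (lebesgue_cV n) (lebesgue_cV_sigma_finite n).

Lemma lebesgue_cV_box n (A : 'I_n -> set R) : (forall i, measurable (A i)) ->
  lebesgue_cV n [set v | forall i, A i (v i 0)] =
  (\prod_(i < n) lebesgue_measure (A i))%E.
Proof.
move=> mA.
rewrite -[RHS](@power_measure_box _ (measurableTypeR R) R lebesgue_measure n A)//.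
congr (power_measure _ _ _).
by apply/seteqP; split => t /= h i; have := h i; rewrite mxE.
Qed.

(* The product over the columns of the Lebesgue measure on 'cV[R]_m. *)
Definition lebesgue_mx m n : set 'M[R]_(m, n) -> \bar R :=
  pushforward (power_measure (lebesgue_cV m) n) (@mx_of_cols m n).
Arguments lebesgue_mx m n A : clear implicits.

Let measurable_mx_of_cols m n : measurable_fun setT (@mx_of_cols m n).
Proof.
apply: measurable_fun_matrix => i j.
rewrite (_ : (fun _ => _) = (fun v : 'cV[R]_m => v i 0) \o (@tnth n _)^~ j).
  apply: measurableT_comp; [exact: measurable_entry|exact: measurable_tnth].
by apply/funext => t; rewrite mxE.
Qed.

Lemma measurable_col m n j : measurable_fun setT (@col R m n j).
Proof.
apply: measurable_fun_matrix => i k.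
rewrite (_ : (fun _ => _) = (fun M : 'M[R]_(m, n) => M i j)).
  exact: measurable_entry.
by apply/funext => t; rewrite mxE.
Qed.

Let lebesgue_mxP m n :
  exists mu : {sigma_finite_measure set 'M[R]_(m, n) -> \bar R},
    mu = lebesgue_mx m n :> (set _ -> _).
Proof.
apply: (@pushforward_sigma_finite_measure _ _ _ _ _
  (power_measure (lebesgue_cV m) n) _
  (fun M : 'M[R]_(m, n) => [tuple col j M | j < n])).
- exact: measurable_mx_of_cols.
- apply/measurable_fun_tnthP => j.
  rewrite (_ : _ \o _ = @col R m n j); first exact: measurable_col.
  by apply/funext => v /=; rewrite tnth_mktuple.
- move=> t; apply: eq_from_tnth => j; rewrite tnth_mktuple.
  by apply/colP => i; rewrite !mxE.
Qed.

Let lebesgue_mx0 m n : lebesgue_mx m n set0 = 0%E.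
Proof. by have [mu <-] := lebesgue_mxP m n; exact: measure0. Qed.

Let lebesgue_mx_ge0 m n A : (0 <= lebesgue_mx m n A)%E.
Proof. by have [mu <-] := lebesgue_mxP m n; exact: measure_ge0. Qed.

Let lebesgue_mx_sigma_additive m n : semi_sigma_additive (lebesgue_mx m n).
Proof.
by have [mu <-] := lebesgue_mxP m n; exact: measure_semi_sigma_additive.
Qed.

HB.instance Definition _ m n := isMeasure.Build _ _ _ (lebesgue_mx m n)
  (lebesgue_mx0 m n) (@lebesgue_mx_ge0 m n) (@lebesgue_mx_sigma_additive m n).

Let lebesgue_mx_sigma_finite m n : sigma_finite setT (lebesgue_mx m n).
Proof. by have [mu <-] := lebesgue_mxP m n; exact: sigma_finiteT. Qed.

HB.instance Definition _ m n := Measure_isSigmaFinite.Build _ _ _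
  (lebesgue_mx m n) (lebesgue_mx_sigma_finite m n).

Lemma lebesgue_mx_cols m n (A : 'I_n -> set 'cV[R]_m) :
  (forall j, measurable (A j)) ->
  lebesgue_mx m n [set M | forall j, A j (col j M)] =
  (\prod_(j < n) lebesgue_cV m (A j))%E.
Proof.
move=> mA; rewrite -(power_measure_box _ mA); congr (power_measure _ _ _).
have colE (t : n.-tuple 'cV[R]_m) j : col j (mx_of_cols t) = tnth t j.
  by apply/colP => i; rewrite !mxE.
by apply/seteqP; split => t /= h j; have := h j; rewrite colE.
Qed.

End lebesgue_on_matrices.
Arguments lebesgue_cV {R} n A.
Arguments lebesgue_mx {R} m n A.

Section probability_notions.
Context d (Omega : measurableType d) d' (T : measurableType d') (R : realType).

Definition has_density (rho mu : {measure set T -> \bar R}) (f : T -> R) :=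
  [/\ measurable_fun setT f,
      forall x, 0 <= f x &
      forall A, measurable A -> rho A = (\int[mu]_(x in A) (f x)%:E)%E].

Definition same_distribution (P : probability Omega R)
    (X Y : {RV P >-> T}) :=
  forall A, measurable A -> distribution P X A = distribution P Y A.

Definition mutually_independent (P : probability Omega R) (I : finType)
    (X : I -> {RV P >-> T}) :=
  forall (J : {set I}) (A : I -> set T), (forall i, measurable (A i)) ->
    P (\bigcap_(i in [set` J]) (X i @^-1` A i)) =
    (\prod_(i in J) P (X i @^-1` A i))%E.

End probability_notions.

Section kernel_density_estimate.
Context {R : realType}.

(* The norm already carried by 'cV[R]_n is the sup norm. *)
Definition euclidean_norm n (v : 'cV[R]_n) : R :=
  Num.sqrt (\sum_(i < n) v i 0 ^+ 2).

(* Silverman's rule for N samples in dimension nu. *)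
Definition bandwidth (nu N : nat) : R :=
  (4 / (N%:R * (nu%:R + 2))) `^ (1 / (nu%:R + 4)).

(* Chosen so that, for centered samples with empirical covariance 1%:M, the
   density kernel_density below has mean 0 and covariance 1%:M. *)
Definition modified_bandwidth (nu N : nat) : R :=
  let s := bandwidth nu N in
  s * (s ^+ 2 + (N%:R - 1) / N%:R) `^ (- (1 / 2)).

Definition gaussian_kernel (nu N : nat) (eta : 'cV[R]_nu) : R :=
  let shat := modified_bandwidth nu N in
  1 / (Num.sqrt (2 * pi) * shat) ^+ nu *
  expR (- (1 / (2 * shat ^+ 2) * euclidean_norm eta ^+ 2)).

Definition kernel_density (nu N : nat) (eta_d : 'I_N -> 'cV[R]_nu)
    (eta : 'cV[R]_nu) : R :=
  1 / N%:R * \sum_(j < N) gaussian_kernel N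
    ((modified_bandwidth nu N / bandwidth nu N) *: eta_d j - eta).

End kernel_density_estimate.

(* Main.v *)
From HB Require Import structures.
Require Import Defs.
From mathcomp Require Import all_boot all_order all_algebra.
From mathcomp Require Import all_classical all_reals all_analysis.
From mathcomp Require Import measurable_realfun.

Set Implicit Arguments.
Unset Strict Implicit.
Unset Printing Implicit Defensive.

Import Order.TTheory GRing.Theory Num.Theory.
Import numFieldNormedType.Exports.

Local Open Scope classical_set_scope.
Local Open Scope ring_scope.

(** The law of a random matrix with independent columns is determined by its
    values on the boxes [set M | forall j, A j (col j M)]: they are stable under
    intersection and generate the sigma-algebra of matrices, so two measures
    that agree on them, one of them finite, are equal (eq_measure_col_box).
    On such a box, independence makes the law equal to the product over j of the
    probabilities that column j lies in A j, that is to the product of the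
    integrals over the A j of the densities of the columns. The candidate
    density, the product over j of these densities at the j-th column, has the
    same integral over the box: multiplied by the indicator of the box it is
    still a product of functions of one column each, and by Tonelli its integral
    factors (integral_lebesgue_mx_col_box). This is
    has_density_independent_columns, for arbitrary column densities.

    Here every column is distributed as H, so all the column densities are the
    kernel density estimate, and the product formula is the one to be proved. *)

(** * Tonelli's theorem on finite powers of a measure *)

Section tonelli_power_measure.
Context d (T : measurableType d) (R : realType).
Variable mu : {sigma_finite_measure set T -> \bar R}.
Local Open Scope ereal_scope.

(** The 0-tuples form a single point, which has mass 1. *)
Lemma integral_power_measure0 (g : 0.-tuple T -> \bar R) :
  \int[power_measure mu 0]_t g t = g [tuple].
Proof.
rewrite (eq_measure_integral (\d_([tuple] : 0.-tuple T))) => [|A _ _ //].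
rewrite integral_dirac// ?diracT ?mul1e//.
move=> _ Y mY; rewrite setTI.
case: (pselect (Y (g [tuple]))) => Yg.
  rewrite (_ : _ @^-1` _ = setT)//.
  by apply/seteqP; split => t //= _; rewrite tuple0.
rewrite (_ : _ @^-1` _ = set0)//.
by apply/seteqP; split => t //=; rewrite tuple0.
Qed.

Lemma ge0_integral_power_measureS n (g : n.+1.-tuple T -> \bar R) :
  measurable_fun setT g -> (forall t, 0 <= g t) ->
  \int[power_measure mu n.+1]_t g t =
  \int[mu]_x \int[power_measure mu n]_t g (consp (x, t)).
Proof.
move=> mg g0.
have mcons : measurable_fun setT (@consp d T n) by exact: measurable_cons.
transitivity (\int[pushforward (mu \x power_measure mu n) (@consp d T n)]_t g t).
  by [].
rewrite (ge0_integral_pushforward mcons)//.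
rewrite preimage_setT fubini_tonelli1//; last by move=> z; exact: g0.
exact: measurableT_comp.
Qed.

Lemma measurable_prod_tnth n (f : 'I_n -> T -> R) :
  (forall i, measurable_fun setT (f i)) ->
  measurable_fun setT (fun t : n.-tuple T => \prod_(i < n) f i (tnth t i))%R.
Proof.
move=> mf; apply: measurable_prod => i _.
by apply: measurableT_comp; [exact: mf|exact: measurable_tnth].
Qed.

(** By Tonelli, integrating out the first coordinate last: the inner integral is
    the factor of that coordinate times a constant known by induction. *)
Lemma integral_power_measure_prod n (f : 'I_n -> T -> R) :
  (forall i, measurable_fun setT (f i)) -> (forall i x, 0 <= f i x)%R ->
  \int[power_measure mu n]_t (\prod_(i < n) f i (tnth t i))%:E =
  \prod_(i < n) \int[mu]_x (f i x)%:E.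
Proof.
elim: n f => [|n IH] f mf f0.
  by rewrite integral_power_measure0 !big_ord0.
rewrite ge0_integral_power_measureS; last 2 first.
- by apply/measurable_EFinP; exact: measurable_prod_tnth.
- by move=> t; rewrite lee_fin prodr_ge0.
rewrite big_ord_recl -(IH (fun i => f (lift ord0 i)))//.
set I := \int[power_measure mu n]_t _.
have I0 : 0 <= I by apply: integral_ge0 => t _; rewrite lee_fin prodr_ge0.
transitivity (\int[mu]_x (I * (f ord0 x)%:E)); last first.
  rewrite ge0_integralZl//; first by rewrite muleC.
  - exact/measurable_EFinP/mf.
  - by move=> x _; rewrite lee_fin.
apply: eq_integral => x _.
rewrite muleC /I -ge0_integralZl//.
- apply: eq_integral => t _; rewrite big_ord_recl /= EFinM.
  by congr (_ * (_)%:E); apply: eq_bigr => i _; rewrite tnthS.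
- apply/measurable_EFinP.
  by apply: (measurable_prod_tnth (f := fun i => f (lift ord0 i))) => i.
- by move=> t _; rewrite lee_fin prodr_ge0.
- by rewrite lee_fin.
Qed.

End tonelli_power_measure.

(** * Measures defined by a density *)

Section density_measure.
Context d (T : measurableType d) (R : realType).
Variables (mu : {measure set T -> \bar R}) (f : T -> R).
Hypotheses (mf : measurable_fun setT f) (f0 : forall x, 0 <= f x).
Local Open Scope ereal_scope.

(** Packs the integral against a density into a measure, to which the uniqueness
    theorem for measures applies. *)
Lemma density_measure_exists : exists m : {measure set T -> \bar R},
  forall A, measurable A -> m A = \int[mu]_(x in A) (f x)%:E.
Proof.
pose m A := \int[mu]_(x in A) (f x)%:E.
have m0 : m set0 = 0 by rewrite /m integral_set0.
have m_ge0 A : 0 <= m A by apply: integral_ge0 => x _; rewrite lee_fin.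
have madd : semi_sigma_additive m.
  move=> F mF tF mUF; rewrite /m ge0_integral_bigcup//.
  - by apply: is_cvg_ereal_nneg_natsum => n _; exact: m_ge0.
  - exact/measurable_EFinP/measurable_funTS.
  - by move=> x _; rewrite lee_fin.
pose Hm := isMeasure.Build _ _ _ m m0 m_ge0 madd.
pose m' := HB.pack_for (measure T R) m Hm.
by exists m'.
Qed.

End density_measure.

(** * Boxes of columns in the space of matrices *)

Section matrix_columns.
Context (R : realType) (m n : nat).

Definition col_box (A : 'I_n -> set 'cV[R]_m) : set 'M[R]_(m, n) :=
  [set M | forall j, A j (col j M)].

Definition col_boxes : set (set 'M[R]_(m, n)) :=
  [set B | exists2 A : 'I_n -> set 'cV[R]_m,
     (forall j, measurable (A j)) & B = col_box A].

Lemma measurable_col_box (A : 'I_n -> set 'cV[R]_m) :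
  (forall j, measurable (A j)) -> measurable (col_box A).
Proof.
move=> mA; rewrite (_ : col_box A = \bigcap_(j in [set: 'I_n]) (col j @^-1` A j)).
  apply: fin_bigcap_measurable => // j _.
  by rewrite -[X in measurable X]setTI; exact: measurable_col.
by apply/seteqP; split => M /= h j; [move=> _|]; exact: h.
Qed.

Lemma col_boxes_setI_closed : setI_closed col_boxes.
Proof.
move=> _ _ [A mA ->] [B mB ->]; exists (fun j => A j `&` B j).
  by move=> j; exact: measurableI.
apply/seteqP; split => M /=; first by move=> [hA hB] j; split.
by move=> h; split => j; case: (h j).
Qed.

(** The event that the entry (i, j) lies in B is the box that constrains column
    j alone, to have its i-th entry in B. *)
Lemma measurable_mxE :
  (measurable : set (set 'M[R]_(m, n))) = <<s col_boxes >>.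
Proof.
apply/seteqP; split; last first.
  apply: smallest_sub; first exact: sigma_algebra_measurable.
  by move=> _ [A mA ->]; exact: measurable_col_box.
apply: smallest_sub; first exact: smallest_sigma_algebra.
move=> _ [[i j] _] [B mB <-] /=; apply: sub_sigma_algebra.
exists (fun k => if k == j then (fun v : 'cV[R]_m => v i 0) @^-1` B else setT).
  move=> k; case: ifP => // _.
  by rewrite -[X in measurable X]setTI; exact: measurable_entry.
rewrite setTI; apply/seteqP; split => M /= h.
  by move=> k; case: ifPn => // /eqP -> /=; rewrite mxE.
by have := h j; rewrite eqxx /= mxE.
Qed.

(** Uniqueness theorem for the pi-system of boxes; the whole space is a box, so
    total finiteness suffices. *)
Lemma eq_measure_col_box (m1 m2 : {measure set 'M[R]_(m, n) -> \bar R}) :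
  (m1 setT < +oo)%E ->
  (forall A : 'I_n -> set 'cV[R]_m, (forall j, measurable (A j)) ->
    m1 (col_box A) = m2 (col_box A)) ->
  forall B, measurable B -> m1 B = m2 B.
Proof.
move=> m1oo m12; apply: (@measure_unique _ _ _ col_boxes (fun=> setT)) => //.
- exact: measurable_mxE.
- exact: col_boxes_setI_closed.
- by move=> _; exists (fun=> setT) => //; apply/seteqP; split.
- by rewrite bigcup_const.
- by move=> _ [A mA ->]; exact: m12.
Qed.

Lemma measurable_prod_col (f : 'I_n -> 'cV[R]_m -> R) :
  (forall j, measurable_fun setT (f j)) ->
  measurable_fun setT (fun M : 'M[R]_(m, n) => \prod_(j < n) f j (col j M)).
Proof.
move=> mf; apply: measurable_prod => j _.
by apply: measurableT_comp; [exact: mf|exact: measurable_col].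
Qed.

Lemma integral_lebesgue_mx_prod (f : 'I_n -> 'cV[R]_m -> R) :
  (forall j, measurable_fun setT (f j)) -> (forall j v, 0 <= f j v) ->
  (\int[lebesgue_mx m n]_M (\prod_(j < n) f j (col j M))%:E =
   \prod_(j < n) \int[lebesgue_cV m]_v (f j v)%:E)%E.
Proof.
move=> mf f0.
have mmx : measurable_fun setT (@mx_of_cols R m n).
  apply: measurable_fun_matrix => i j.
  rewrite (_ : (fun _ => _) = (fun v : 'cV[R]_m => v i 0) \o (@tnth n _)^~ j).
    apply: measurableT_comp; [exact: measurable_entry|exact: measurable_tnth].
  by apply/funext => t; rewrite mxE.
rewrite -integral_power_measure_prod//.
transitivity (\int[pushforward (power_measure (lebesgue_cV m) n)
  (@mx_of_cols R m n)]_M (\prod_(j < n) f j (col j M))%:E)%E; first by [].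
rewrite (ge0_integral_pushforward mmx)//; last 2 first.
- by apply/measurable_EFinP; exact: measurable_prod_col.
- by move=> M _; rewrite lee_fin prodr_ge0.
rewrite preimage_setT; apply: eq_integral => t _ /=.
congr (_ %:E); apply: eq_bigr => j _; congr (f j _).
by apply/colP => i; rewrite !mxE.
Qed.

(** The indicator of a box is the product of the indicators of its sides, so
    restricting to it amounts to replacing each f j by its restriction to A j. *)
Lemma integral_lebesgue_mx_col_box (f : 'I_n -> 'cV[R]_m -> R)
    (A : 'I_n -> set 'cV[R]_m) :
  (forall j, measurable_fun setT (f j)) -> (forall j v, 0 <= f j v) ->
  (forall j, measurable (A j)) ->
  (\int[lebesgue_mx m n]_(M in col_box A) (\prod_(j < n) f j (col j M))%:E =
   \prod_(j < n) \int[lebesgue_cV m]_(v in A j) (f j v)%:E)%E.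
Proof.
move=> mf f0 mA.
transitivity (\int[lebesgue_mx m n]_M
    (\prod_(j < n) (f j (col j M) * \1_(A j) (col j M)))%:E)%E.
  rewrite integral_mkcond epatch_indic; apply: eq_integral => M _ /=.
  rewrite big_split /= EFinM; congr (_ * _%:E)%E.
  rewrite indicE; case: (boolP (M \in col_box A)) => [/set_mem AM|AM].
    by rewrite big1// => j _; rewrite indicE mem_set.
  have [j Aj] : exists j, ~ A j (col j M).
    by apply/existsNP => AM'; move: AM; rewrite mem_set.
  by rewrite (bigD1 j)//= indicE memNset// mul0r.
rewrite (integral_lebesgue_mx_prod
  (f := fun j v => f j v * \1_(A j) v))//; last 2 first.
- by move=> j; apply: measurable_funM => //; exact: measurable_indic.
- by move=> j v; rewrite mulr_ge0.
apply: eq_bigr => j _; rewrite [RHS]integral_mkcond epatch_indic.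
by apply: eq_integral => v _ /=; rewrite EFinM.
Qed.

End matrix_columns.

(** * Random matrices with independent columns *)

(** The law of Y and the measure with the product density are compared on boxes,
    where independence on one side and Tonelli on the other give the same
    product. *)
Lemma has_density_independent_columns (R : realType) (m n : nat)
    (d : measure_display) (Omega : measurableType d) (P : probability Omega R)
    (X : 'I_n -> {RV P >-> 'cV[R]_m}) (f : 'I_n -> 'cV[R]_m -> R)
    (Y : {RV P >-> 'M[R]_(m, n)}) :
  (forall j, has_density (distribution P (X j)) (lebesgue_cV m) (f j)) ->
  mutually_independent X -> (forall w j, col j (Y w) = X j w) ->
  has_density (distribution P Y) (lebesgue_mx m n)
    (fun M => \prod_(j < n) f j (col j M)).
Proof.
move=> Xf indep YX.
have mf j : measurable_fun setT (f j) by case: (Xf j).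
have f0 j v : 0 <= f j v by case: (Xf j).
have mg := measurable_prod_col mf.
have g0 M : 0 <= \prod_(j < n) f j (col j M) by exact: prodr_ge0.
split => // B mB.
have [rho rhoE] := density_measure_exists (lebesgue_mx m n) mg g0.
rewrite -rhoE//; apply: eq_measure_col_box B mB => [|A mA].
  exact: le_lt_trans (probability_le1 (distribution P Y) measurableT) (ltry 1).
rewrite rhoE; last exact: measurable_col_box.
rewrite integral_lebesgue_mx_col_box//.
transitivity (P (\bigcap_(j in [set` [set: 'I_n]%SET]) (X j @^-1` A j))).
  congr (P _); apply/seteqP; split => w /= h.
    by move=> j _ /=; rewrite -YX; exact: h.
  by move=> j; rewrite YX; apply: (h j); rewrite /= inE.
rewrite indep//; apply: eq_big => [j|j _]; first by rewrite inE.
by have [_ _ <-] := Xf j.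
Qed.

Theorem proposition1 (R : realType) (nu N : nat)
    (nu_ge1 : (1 <= nu)%N) (nu_ltN : (nu < N)%N)
    (eta_d : 'I_N -> 'cV[R]_nu)
    (eta_d_mean : \sum_(j < N) eta_d j = 0)
    (eta_d_cov :
      (1 / (N%:R - 1)) *: \sum_(j < N) eta_d j *m (eta_d j)^T = 1%:M)
    (d : measure_display) (Omega : measurableType d) (P : probability Omega R)
    (H : {RV P >-> 'cV[R]_nu})
    (H_pdf : has_density (distribution P H) (lebesgue_cV nu)
      (kernel_density eta_d))
    (Hcol : 'I_N -> {RV P >-> 'cV[R]_nu})
    (Hcol_copies : forall l, same_distribution (Hcol l) H)
    (Hcol_indep : mutually_independent Hcol)
    (HN : {RV P >-> 'M[R]_(nu, N)})
    (HN_cols : forall w l, col l (HN w) = Hcol l w) :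
  let s := bandwidth nu N in
  let shat := modified_bandwidth nu N in
  has_density (distribution P HN) (lebesgue_mx nu N)
    (fun eta : 'M[R]_(nu, N) =>
      \prod_(l < N)
        (1 / N%:R * \sum_(j < N)
          (1 / (Num.sqrt (2 * pi) * shat) ^+ nu *
           expR (- (1 / (2 * shat ^+ 2) *
             euclidean_norm ((shat / s) *: eta_d j - col l eta) ^+ 2))))).
Proof.
move=> s shat.
(* The l-th factor is kernel_density eta_d (col l eta), by conversion. *)
apply: (has_density_independent_columns (f := fun=> kernel_density eta_d) _
  Hcol_indep HN_cols) => l.
have [mp p0 Hp] := H_pdf; split => // A mA.
by rewrite -Hp//; exact: Hcol_copies.
Qed.
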